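(* Let $\mathcal{G}=(\mathcal{V},\mathcal{E})$ be a generically $d$-rigid graph on $n$ vertices, let $p^*\in\mathbb{R}^{dn}$ be a regular point of the distance map $F$ (that is, $p^*\in\mathcal{C}$), and let $m^*=F(p^* )$, so that $(p^*,m^* )\in\mathcal{S}$ is the target state. Let $\overrightarrow{\mathcal{G}}$ be an orientation of $\mathcal{G}$, with associated matrix $\overrightarrow{R}(p)$. Let $P$ be a matrix with linearly independent columns spanning the column space of $R(p^* )$, and let $Z=2R(p^* )\,\overrightarrow{R}(p^* )^\top$. If $\tfrac12P^\top(Z+Z^\top)P$ is positive definite, then trajectories of the directed controller $$\dot p=-\overrightarrow{R}(p)^\top\bigl(R(p)p-m^*\bigr)$$ starting sufficiently close to $p^*$ converge exponentially to a configuration $q$ with $F(q)=m^*$.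
   Context: Setting. $\mathcal{G}=(\mathcal{V},\mathcal{E})$ is a finite simple undirected graph with $\mathcal{V}=\{1,\dots,n\}$, and $d\ge1$. A configuration is $p=(p_1,\dots,p_n)\in(\mathbb{R}^d)^n=\mathbb{R}^{dn}$. Two configurations are congruent if they differ by an isometry of $\mathbb{R}^d$ applied to all points. Norms are Euclidean. Distance map: $F:\mathbb{R}^{dn}\to\mathbb{R}^{|\mathcal{E}|}$, $F(p)=(\|p_j-p_i\|^2)_{ij\in\mathcal{E}}$. Rigidity matrix: $R(p)\in\mathbb{R}^{|\mathcal{E}|\times dn}$; the row of the edge $ij$ has $(p_i-p_j)^\top$ in the block of columns of vertex $i$, $(p_j-p_i)^\top$ in the block of vertex $j$, and zeros elsewhere. Thus $R(p)p=F(p)$ and $\mathrm{d}F_p=2R(p)$. Directed rigidity matrix: an orientation $\overrightarrow{\mathcal{G}}$ assigns to every edge of $\mathcal{G}$ exactly one direction. $\overrightarrow{R}(p)$ is obtained from $R(p)$ by zeroing out, in the row of each edge, the entries in the block of the head of the directed edge: if $ij$ is oriented from $i$ to $j$, the block of $j$ in that row is set to zero, so the row has only the block $(p_i-p_j)^\top$ at vertex $i$. Regular values and points: let $r=\max_p\mathrm{rk}\,R(p)$. $\mathcal{Q}$ is the set of regular values of $F$: the points $m\in\mathrm{Im}\,F$ near which $\mathrm{Im}\,F$ is an embedded smooth submanifold of $\mathbb{R}^{|\mathcal{E}|}$ of dimension $r$ and such that $\mathrm{rk}\,R(p)=r$ for every $p\in F^{-1}(m)$. $\mathcal{C}:=F^{-1}(\mathcal{Q})$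 is the set of regular points, and $\mathcal{S}=\{(p,m)\in\mathcal{C}\times\mathcal{Q}:F(p)=m\}$. Rigidity: $(\mathcal{G},p)$ is locally rigid if there is a neighborhood of $p$ in which every $q$ with $F(q)=F(p)$ is congruent to $p$. $\mathcal{G}$ is (generically) $d$-rigid if $(\mathcal{G},p)$ is locally rigid for every regular $p$ (equivalently, for every generic $p$). Exponential convergence of trajectories starting sufficiently close to $p^*$ means: there are a neighborhood $U$ of $p^*$ and $K,k>0$ such that for every $p(0)\in U$ the trajectory exists for all $t\ge0$ and there is $q$ (depending on $p(0)$), with $F(q)=m^*$, such that $\|q-p(t)\|\le Ke^{-kt}$ for all $t\ge0$. *)

(* Defs.v *)
From HB Require Import structures.
From mathcomp Require Import all_boot all_order all_algebra.
From mathcomp Require Import all_classical all_reals all_analysis.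
Set Implicit Arguments.
Unset Strict Implicit.
Unset Printing Implicit Defensive.
Import Order.TTheory GRing.Theory Num.Theory.
Import numFieldNormedType.Exports.
Local Open Scope classical_set_scope.
Local Open Scope ring_scope.

Section Euclidean.
Variable R : realType.

(* The library norm on matrices is the max norm; it induces the same topology,
   which is the one used by the filters and derivatives below. *)
Definition enorm m k (A : 'M[R]_(m, k)) : R :=
  Num.sqrt (\sum_i \sum_j A i j ^+ 2).

Definition isometry_rV d (g : 'rV[R]_d -> 'rV[R]_d) : Prop :=
  forall x y, enorm (g x - g y) = enorm (x - y).

Definition posdefmx m (A : 'M[R]_m) : Prop :=
  forall v : 'cV[R]_m, v != 0 -> 0 < (v^T *m A *m v) 0 0.

(* C^k on an open set U, through iterated directional derivatives. *)
Fixpoint Ck m l (k : nat) (U : set 'cV[R]_m) (f : 'cV[R]_m -> 'cV[R]_l) : Prop :=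
  match k with
  | 0 => forall x, U x -> {for x, continuous f}
  | k'.+1 => (forall x, U x -> differentiable f x) /\
             (forall v, Ck k' U ('D_v f))
  end.

Definition smooth_on m l (U : set 'cV[R]_m) (f : 'cV[R]_m -> 'cV[R]_l) : Prop :=
  forall k, Ck k U f.

Definition diffeo_on N (U W : set 'cV[R]_N) (phi psi : 'cV[R]_N -> 'cV[R]_N) :
    Prop :=
  [/\ open U /\ open W,
      smooth_on U phi /\ smooth_on W psi,
      (forall x, U x -> W (phi x) /\ psi (phi x) = x) &
      (forall y, W y -> U (psi y) /\ phi (psi y) = y)].

(* M is covered by slice charts of R^N: diffeomorphisms between open sets that
   carry M onto the vanishing locus of the coordinates of index >= r. *)
Definition embedded_submanifold N (r : nat) (M : set 'cV[R]_N) : Prop :=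
  (r <= N)%N /\
  forall y, M y -> exists U W phi psi,
    [/\ U y, diffeo_on U W phi psi &
        forall x, U x ->
          (M x <-> forall i : 'I_N, (r <= i)%N -> phi x i 0 = 0)].

Definition embedded_submanifold_near N (r : nat) (M : set 'cV[R]_N) y : Prop :=
  exists O, [/\ open O, O y & embedded_submanifold r (M `&` O)].

(* Classical solution on [0, +oo[: the derivative at 0 is one-sided, and the
   values of x at negative times are irrelevant. *)
Definition trajectory m (f : 'cV[R]_m -> 'cV[R]_m) (x : R -> 'cV[R]_m) : Prop :=
  (forall t : R, 0 < t -> is_derive t 1 x (f (x t))) /\
  (h^-1 *: (x h - x 0) @[h --> 0^'+] --> f (x 0)).

(* The quantification over all x starting at x0 makes the claim one about the
   trajectory from x0, whichever function represents it. *)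
Definition exp_convergent_near m (f : 'cV[R]_m -> 'cV[R]_m) (A : set 'cV[R]_m)
    (xstar : 'cV[R]_m) : Prop :=
  exists U K k, [/\ nbhs xstar U, 0 < K, 0 < k &
    forall x0, U x0 ->
      (exists x, trajectory f x /\ x 0 = x0) /\
      (forall x, trajectory f x -> x 0 = x0 ->
         exists q, A q /\
           forall t, 0 <= t -> enorm (q - x t) <= K * expR (- (k * t)))].

End Euclidean.

Section Graph.
Variable n : nat.
Implicit Types e o : rel 'I_n.

Definition simple_graph e : Prop := symmetric e /\ irreflexive e.

(* An edge {i, j} is listed once, as the pair (i, j) with i < j. *)
Definition edges e : {set 'I_n * 'I_n} :=
  [set ij : 'I_n * 'I_n | (ij.1 < ij.2)%N && e ij.1 ij.2].

Definition end1 e (a : 'I_#|edges e|) : 'I_n := (enum_val a).1.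
Definition end2 e (a : 'I_#|edges e|) : 'I_n := (enum_val a).2.

(* o i j: the edge {i, j} is oriented from i to j. *)
Definition orientation e o : Prop :=
  (forall i j, o i j -> e i j) /\ (forall i j, e i j -> o i j (+) o j i).

Definition head_of e o (a : 'I_#|edges e|) : 'I_n :=
  if o (end1 a) (end2 a) then end2 a else end1 a.

End Graph.

Section Rigidity.
Variables (R : realType) (n d : nat).
Implicit Types (e o : rel 'I_n) (p q : 'cV[R]_(n * d)).

(* Coordinate k of the point of vertex i is the entry mxvec_index i k of p. *)
Definition vertex_pt p (i : 'I_n) : 'rV[R]_d := row i (vec_mx p^T).

Definition congruent p q : Prop :=
  exists2 g, isometry_rV g & forall i, vertex_pt q i = g (vertex_pt p i).

Definition distance_map e p : 'cV[R]_#|edges e| :=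
  \col_a enorm (vertex_pt p (end2 a) - vertex_pt p (end1 a)) ^+ 2.

Definition edge_block e p (a : 'I_#|edges e|) (v : 'I_n) : 'rV[R]_d :=
  if v == end1 a then vertex_pt p (end1 a) - vertex_pt p (end2 a)
  else if v == end2 a then vertex_pt p (end2 a) - vertex_pt p (end1 a)
  else 0.

Definition rigidity_mx e p : 'M[R]_(#|edges e|, n * d) :=
  \matrix_a mxvec (\matrix_v edge_block p a v).

Definition dir_rigidity_mx e o p : 'M[R]_(#|edges e|, n * d) :=
  \matrix_a mxvec (\matrix_v (if v == head_of o a then 0 else edge_block p a v)).

Definition max_rank e : nat :=
  \max_(k < #|edges e|.+1 | `[< exists p, \rank (rigidity_mx e p) = k >]) k.

Definition regular_values e : set 'cV[R]_#|edges e| :=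
  [set m | [/\ range (distance_map e) m,
     embedded_submanifold_near (max_rank e) (range (distance_map e)) m &
     forall p, distance_map e p = m -> \rank (rigidity_mx e p) = max_rank e]].
Arguments regular_values : clear implicits.

Definition regular_points e : set 'cV[R]_(n * d) :=
  distance_map e @^-1` (regular_values e).

Definition locally_rigid e p : Prop :=
  \forall q \near p, distance_map e q = distance_map e p -> congruent p q.

Definition generically_rigid e : Prop :=
  forall p, regular_points e p -> locally_rigid e p.

Definition directed_controller e o (m : 'cV[R]_#|edges e|) p :
    'cV[R]_(n * d) :=
  - ((dir_rigidity_mx e o p)^T *m (rigidity_mx e p *m p - m)).

End Rigidity.

Arguments distance_map {R n d} e p.
Arguments rigidity_mx {R n d} e p.
Arguments dir_rigidity_mx {R n d} e o p.
Arguments max_rank R {n} d e.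
Arguments regular_values R {n} d e.
Arguments regular_points R {n} d e.
Arguments locally_rigid {R n d} e p.
Arguments generically_rigid R {n} d e.

(* Main.v *)
Require Import Defs.
From HB Require Import structures.
From mathcomp Require Import all_boot all_order all_algebra.
From mathcomp Require Import all_classical all_reals all_analysis.
From mathcomp Require Import ring lra.
Set Implicit Arguments.
Unset Strict Implicit.
Unset Printing Implicit Defensive.
Import Order.TTheory GRing.Theory Num.Theory.
Import numFieldNormedType.Exports.
Local Open Scope classical_set_scope.
Local Open Scope ring_scope.

(** Write [F p = R(p) p] for the distance map, [D(p)] for the directed rigidity
    matrix, [y = F p - mstar] and [Z(p) = 2 R(p) D(p)^T].  Along a trajectory
    [y' = 2 R(p) p' = - Z(p) y], so [V = y^T y] satisfies [V' = - 2 y^T Z(p) y],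
    and everything rests on a bound [c V <= y^T Z(p) y] near [pstar].  The matrix
    [Z(pstar)] is only positive on the column space of [R(pstar)], and there is
    no reason for [y] to lie in it.

    The regularity of [mstar] repairs this.  Near [mstar] the image of [F] is a
    submanifold whose dimension is the rank of [R(pstar)], so its tangent space
    at [mstar] is exactly the column space of [R(pstar)].  A slice chart turns
    this into a matrix [G] whose kernel is that column space and for which
    [G y = o(y)] as [p] tends to [pstar] ([submanifold_tangent]).  Compactness of
    the unit sphere gives [c > 0] such that [|G y| <= c |y|] forces
    [c |y|^2 <= y^T Z(pstar) y] ([quad_coercive]), and continuity of [Z] moves
    the bound from [pstar] to the nearby [p] (the step [dissipation]).

    Then [V] decays exponentially as long as the trajectory is near [pstar].
    Since [|p'| <= C sqrt V], the length of the trajectory is at most a multiple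
    of the initial value of [sqrt V]: a trajectory starting close enough never
    leaves the neighbourhood and converges exponentially to a zero of [V], that
    is to a [q] with [F q = mstar] ([lyapunov_decay]).  Confinement comes from
    this finite length.

    Existence for all times is obtained from a global Picard-Lindelof theorem
    for bounded Lipschitz fields ([picard_lindelof]): the controller is composed
    with the coordinatewise projection onto a box around [pstar], and the same
    confinement argument shows that the solution of the modified equation never
    meets the modification.

    What enters of the graph is that [R(p)] and [D(p)] are linear in [p] and that
    [R(p) h = R(h) p]; the argument is carried out for such a pair of
    matrix-valued maps ([quadratic_flow_converges]). *)

(** * Max norm and derivatives of matrix-valued maps *)

Section MatrixNorm.
Variables (R : realType).

Lemma mx_norm_leP m k (A : 'M[R]_(m, k)) (c : R) : 0 <= c ->
  reflect (forall i j, `|A i j| <= c) (`|A| <= c).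
Proof.
move=> c0; rewrite [`|A|]/Num.Def.normr/= mx_normrE; apply: (iffP idP).
  move=> /bigmax_leP[_ h] i j; exact: (h (i, j)).
by move=> h; apply/bigmax_leP; split => // -[i j] _; exact: h.
Qed.

Lemma mx_norm_entry m k (A : 'M[R]_(m, k)) i j : `|A i j| <= `|A|.
Proof. by have /(_ (lexx _)) := elimT (mx_norm_leP A (normr_ge0 A)); apply. Qed.

Lemma is_derive_mx (U : normedModType R) m k (A : U -> 'M[R]_(m, k)) x v
    (dA : 'M[R]_(m, k)) :
  (forall i j, is_derive x v (fun z => A z i j) (dA i j)) -> is_derive x v A dA.
Proof.
move=> h; have dr : derivable A x v.
  by apply/derivable_mxP => i j; have D := h i j; exact: ex_derive.
apply: DeriveDef => //; rewrite derive_mx//; apply/matrixP => i j; rewrite mxE.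
by have D := h i j; exact: derive_val.
Qed.

Lemma is_derive_entry (U : normedModType R) m k (A : U -> 'M[R]_(m, k)) x v
    (dA : 'M[R]_(m, k)) i j :
  is_derive x v A dA -> is_derive x v (fun z => A z i j) (dA i j).
Proof.
move=> [dr dE]; apply: DeriveDef; first by move/derivable_mxP : dr; apply.
by move: dE; rewrite derive_mx// => <-; rewrite mxE.
Qed.

Lemma mx_norm_mulmx a b k (A : 'M[R]_(a, b)) (B : 'M[R]_(b, k)) :
  `|A *m B| <= b%:R * `|A| * `|B|.
Proof.
apply/mx_norm_leP => [|i j]; first by rewrite !mulr_ge0.
rewrite mxE; apply: le_trans (ler_norm_sum _ _ _) _.
rewrite -mulrA -[X in _ <= X%:R * _]card_ord mulr_natl -sumr_const.
by apply: ler_sum => l _; rewrite normrM ler_pM// mx_norm_entry.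
Qed.

Lemma mx_norm_tr a b (A : 'M[R]_(a, b)) : `|A^T| = `|A|.
Proof.
have h c d (B : 'M[R]_(c, d)) : `|B^T| <= `|B|.
  by apply/mx_norm_leP => // i j; rewrite mxE mx_norm_entry.
by apply/eqP; rewrite eq_le h -{1}[A]trmxK h.
Qed.

(** The constant [m%:R + 1], cruder than the square root of [m], is positive
    also in dimension 0. *)
Lemma enorm_le m (x : 'cV[R]_m) : enorm x <= (m%:R + 1) * `|x|.
Proof.
have h0 : 0 <= (m%:R + 1) * `|x| by rewrite mulr_ge0// addr_ge0.
rewrite /enorm -[leRHS]ger0_norm// -sqrtr_sqr ler_wsqrtr//.
apply: (@le_trans _ _ (m%:R * `|x| ^+ 2)).
  rewrite -[X in _ <= X%:R * _]card_ord mulr_natl -sumr_const; apply: ler_sum => i _.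
  rewrite big_ord1 -[X in X <= _]real_normK ?num_real//.
  by rewrite lerXn2r ?nnegrE// mx_norm_entry.
rewrite exprMn ler_wpM2r ?sqr_ge0// expr2.
have := ler0n R m; nra.
Qed.

End MatrixNorm.

(** * Comparison of increments, antiderivatives *)

Section RealCalculus.
Variable R : realType.

Lemma increment_le (u v du dv : R -> R) (a b : R) : a <= b ->
  {within `[a, b], continuous u} -> {within `[a, b], continuous v} ->
  (forall t, a < t < b -> is_derive t 1 u (du t)) ->
  (forall t, a < t < b -> is_derive t 1 v (dv t)) ->
  (forall t, a < t < b -> du t <= dv t) ->
  u b - u a <= v b - v a.
Proof.
move=> ab cu cv Du Dv dudv; move: ab; rewrite le_eqVlt => /predU1P[->|ab].
  by rewrite !subrr.
have cw : {within `[a, b], continuous (v \- u)}.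
  by move=> z; apply: cvgB; [exact: cv|exact: cu].
have Dw t : t \in `]a, b[%R -> is_derive t 1 (v \- u) (dv t - du t).
  rewrite in_itv => tab; have := Du _ tab; have := Dv _ tab => ? ?.
  exact: is_deriveB.
have [c] := MVT ab Dw cw; rewrite in_itv => cab /= E.
have : 0 <= (dv c - du c) * (b - a).
  by rewrite mulr_ge0// subr_ge0 ?(ltW ab)// dudv.
rewrite -E => ?; lra.
Qed.

(** This takes the place of bounding an integral by the integral of a bound: the
    derivative of [u] is dominated by that of an explicit [v]. *)
Lemma norm_increment_le (u du v dv : R -> R) (a b : R) : a <= b ->
  {within `[a, b], continuous u} -> {within `[a, b], continuous v} ->
  (forall t, a < t < b -> is_derive t 1 u (du t)) ->
  (forall t, a < t < b -> is_derive t 1 v (dv t)) ->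
  (forall t, a < t < b -> `|du t| <= dv t) ->
  `|u b - u a| <= v b - v a.
Proof.
move=> ab cu cv Du Dv h; rewrite ler_norml; apply/andP; split; last first.
  apply: (increment_le ab cu cv Du Dv) => t /h; rewrite ler_norml => /andP[_]//.
rewrite lerNl opprB.
have cNu : {within `[a, b], continuous (\- u)}.
  by move=> z; apply: cvgN; exact: cu.
have DNu t : a < t < b -> is_derive t 1 (\- u) (- du t).
  by move=> /Du ?; exact: is_deriveN.
have := increment_le ab cNu cv DNu Dv; rewrite opprK addrC; apply => t /h.
by rewrite ler_norml => /andP[+ _]; rewrite lerNl.
Qed.

(** Integrating from -1 rather than from 0 makes the derivative at 0 two-sided. *)
Lemma antiderivative_exists (g : R -> R) : continuous g ->
  exists G : R -> R, G 0 = 0 /\ forall t : R, -1 < t -> is_derive t 1 G (g t).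
Proof.
move=> cg; pose mu := @lebesgue_measure R.
pose G0 (y : R) := (\int[mu]_(t in `[(-1)%R, y]) g t)%R.
exists (fun t => G0 t - G0 0); split; first by rewrite subrr.
move=> t t1.
have ig : mu.-integrable `[(-1)%R, t + 1] (EFin \o g).
  apply: continuous_compact_integrable; first exact: segment_compact.
  exact: continuous_subspaceT.
have [dG0 EG0] : derivable G0 t 1 /\ derive1 G0 t = g t.
  apply: (continuous_FTC1_closed (u := t + 1)) => //; first by rewrite ltrDl.
  exact: cg.
have iG0 : is_derive t 1 G0 (g t).
  by apply: DeriveDef; [exact: dG0|rewrite -derive1E; exact: EG0].
have : is_derive t 1 (G0 \- cst (G0 0)) (g t - 0) by exact: is_deriveB.
by rewrite subr0.
Qed.

Lemma is_derive_expR_scale (K b t : R) :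
  is_derive t 1 (fun s : R => K * expR (b * s)) (K * (b * expR (b * t))).
Proof.
have D1 : is_derive t 1 (fun s : R => b * s) b.
  have : is_derive t 1 (b \*: (@id R)) (b *: 1) by exact: is_deriveZ.
  by rewrite [_ *: _]mulr1.
have D2 : is_derive t 1 (expR \o (fun s : R => b * s)) (expR (b * t) * b).
  exact: is_derive1_comp.
rewrite [b * expR _]mulrC.
have : is_derive t 1 (K \*: (expR \o (fun s : R => b * s)))
   (K *: (expR (b * t) * b)) by exact: is_deriveZ.
exact.
Qed.

Lemma expR_scale_continuous (K b : R) : continuous (fun s : R => K * expR (b * s)).
Proof.
move=> t; apply/differentiable_continuous/derivable1_diffP.
by have D := is_derive_expR_scale K b t; exact: ex_derive.
Qed.

Lemma le0_geometric (a c : R) : (forall k, a <= c * 2^-1 ^+ k) -> a <= 0.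
Proof.
move=> h; have cv : geometric c (2^-1 : R) @ \oo --> (0 : R).
  by apply: cvg_geometric; rewrite ger0_norm ?invr_ge0// invf_lt1// ltr1n.
rewrite -(cvg_lim _ cv)//; apply: limr_ge; first by apply/cvg_ex; exists 0.
by near=> k; exact: h.
Unshelve. all: by end_near. Qed.

Lemma lipschitz_continuous (V W : normedModType R) (f : V -> W) (K : R) :
  (forall x y, `|f x - f y| <= K * `|x - y|) -> continuous f.
Proof.
move=> fK x; apply/cvgrPdist_le => e e0; apply/nbhs_normP.
have K1 : 0 < `|K| + 1 by rewrite ltr_pwDr.
exists (e / (`|K| + 1)) => [|y /= /ltW]; first by rewrite /= divr_gt0.
rewrite ler_pdivlMr// mulrC; apply: le_trans; apply: (le_trans (fK _ _)).
by rewrite ler_wpM2r// (le_trans (ler_norm K))// lerDl.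
Qed.

End RealCalculus.

(** * Global solutions of Lipschitz differential equations *)

(** Picard iteration on the whole half line at once: the iterates are compared
    in the weight [expR (2 * L * t)], for which the iteration is a contraction
    of ratio 1/2 whatever the length of the time interval. *)
Section Picard.
Variables (R : realType) (m : nat).
Variables (f : 'cV[R]_m -> 'cV[R]_m) (M L : R).
Hypothesis fM : forall x, `|f x| <= M.
Hypothesis L0 : 0 < L.
Hypothesis fL : forall x y, `|f x - f y| <= L * `|x - y|.

Let M0 : 0 <= M. Proof. exact: le_trans (fM 0). Qed.

(* The iterates are made constant on negative times, which leaves them
   continuous on the whole line and restricts all estimates to [t >= 0]. *)
Let clip (t : R) := Num.max t 0.

Let clip_ge0 t : 0 <= clip t. Proof. by rewrite le_max lexx orbT. Qed.

Let clip_id t : 0 <= t -> clip t = t. Proof. by move=> t0; exact: max_l. Qed.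

Let clip_dist s t : `|clip s - clip t| <= `|s - t|.
Proof.
have := ler_norm (s - t); have := ler_norm (t - s); rewrite (distrC t s) => h1 h2.
rewrite ler_norml /clip; case: (leP s 0) => s0; case: (leP t 0) => t0;
  apply/andP; split; lra.
Qed.

Let f_cont : continuous f := lipschitz_continuous fL.

Let prim (g : R -> R) : R -> R :=
  if pselect (continuous g) is left h then sval (cid (antiderivative_exists h))
  else cst 0.

Let prim0 g : prim g 0 = 0.
Proof. by rewrite /prim; case: pselect => // h; case: cid => G []. Qed.

Let primP (g : R -> R) : continuous g ->
  forall t : R, -1 < t -> is_derive t 1 (prim g) (g t).
Proof. by rewrite /prim; case: pselect => // h; case: cid => G []. Qed.

Variable x0 : 'cV[R]_m.

Let sol (y : R -> 'cV[R]_m) (t : R) : 'cV[R]_m :=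
  x0 + \col_i prim (fun s => f (y s) i 0) t.
Let step y t := sol y (clip t).

Let fy_cont (y : R -> 'cV[R]_m) i : continuous y ->
  continuous (fun s => f (y s) i 0).
Proof.
move=> cy t; apply: (@continuous_comp _ _ _ y (fun z => f z i 0)); first exact: cy.
apply: (@continuous_comp _ _ _ f (fun z : 'cV[R]_m => z i 0)); first exact: f_cont.
exact: coord_continuous.
Qed.

Let sol0 y : sol y 0 = x0.
Proof. by apply/colP => i; rewrite !mxE prim0 addr0. Qed.

Let sol_derive y (t : R) : continuous y -> -1 < t -> is_derive t 1 (sol y) (f (y t)).
Proof.
move=> cy t1; apply: is_derive_mx => i j; rewrite (ord1 j).
have D := primP (@fy_cont y i cy) t1.
have -> : (fun s => sol y s i 0) = cst (x0 i 0) \+ prim (fun s => f (y s) i 0).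
  by apply/funext => s; rewrite !mxE.
by rewrite -[X in is_derive _ _ _ X]add0r; exact: is_deriveD.
Qed.

Let entry_cont (u : R -> 'cV[R]_m) du i a b : -1 < a ->
  (forall t : R, -1 < t -> is_derive t 1 u (du t)) ->
  {within `[a, b], continuous (fun t => u t i 0)}.
Proof.
move=> a1 Du; apply: derivable_within_continuous => t.
rewrite in_itv => /andP[at_ _].
have D := is_derive_entry i 0 (Du t (lt_le_trans a1 at_)).
exact: ex_derive.
Qed.

Let step_lip y : continuous y -> forall s t, `|step y s - step y t| <= M * `|s - t|.
Proof.
move=> cy.
have key s t : 0 <= s <= t -> `|sol y t - sol y s| <= M * (t - s).
  move=> /andP[s0 st]; apply/mx_norm_leP => [|i j].
    by rewrite mulr_ge0// subr_ge0.
  rewrite (ord1 j) !mxE -!/(fun_of_matrix _ _ _).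
  have s1 : -1 < s by lra.
  have D (u : R) : s < u < t -> is_derive u 1 (fun w => sol y w i 0) (f (y u) i 0).
    by move=> /andP[su _]; apply: is_derive_entry; apply: sol_derive => //; lra.
  have DM (u : R) : s < u < t -> is_derive u 1 (fun w => M * w) M.
    move=> _; have : is_derive u 1 (M \*: (@id R)) (M *: 1) by exact: is_deriveZ.
    by rewrite [_ *: _]mulr1.
  have cM : {within `[s, t], continuous (fun w => M * w)}.
    by apply: continuous_subspaceT => w; apply: cvgM; [exact: cvg_cst|exact: cvg_id].
  have := norm_increment_le st
    (@entry_cont _ _ i s t s1 (fun u => @sol_derive y u cy)) cM D DM.
  rewrite !mxE mulrBr; apply => u _.
  exact: le_trans (mx_norm_entry _ _ _) (fM _).
move=> s t; apply: (@le_trans _ _ (M * `|clip s - clip t|)); last first.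
  by rewrite ler_wpM2l.
rewrite /step; case: (leP (clip s) (clip t)) => h.
  by rewrite distrC [X in _ * X]distrC ger0_norm ?subr_ge0// key// clip_ge0.
by rewrite [X in _ * X]gtr0_norm ?subr_gt0// key// clip_ge0 ltW.
Qed.

Let w (t : R) := expR (2 * L * clip t).

(* The difference of the two images has derivative at most [L * K * w], and
   [K / 2 * w] is an antiderivative of that bound. *)
Let step_contract (y z : R -> 'cV[R]_m) (K : R) : continuous y -> continuous z ->
  (forall t, `|y t - z t| <= K * w t) ->
  forall t, `|step y t - step z t| <= K / 2 * w t.
Proof.
move=> cy cz h t; rewrite /step.
have K0 : 0 <= K.
  have := le_trans (normr_ge0 _) (h 0); rewrite pmulr_lge0//; exact: expR_gt0.
have t0 := clip_ge0 t; rewrite /w; set s := clip t in t0 *.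
have Dd (u : R) : -1 < u -> is_derive u 1 (sol y \- sol z) (f (y u) - f (z u)).
  move=> u1; have := sol_derive cy u1; have := sol_derive cz u1 => ? ?.
  exact: is_deriveB.
have Du (u : R) i : -1 < u ->
  is_derive u 1 (fun r => (sol y \- sol z) r i 0) ((f (y u) - f (z u)) i 0).
  by move=> u1; apply: is_derive_entry; exact: Dd.
apply/mx_norm_leP => [|i j]; first by rewrite !mulr_ge0// expR_ge0.
rewrite (ord1 j).
have cv : {within `[0, s], continuous (fun r => K / 2 * expR (2 * L * r))}.
  by apply: continuous_subspaceT; exact: expR_scale_continuous.
have := norm_increment_le t0 (@entry_cont _ _ i 0 s (ltrN10 _) Dd) cv
  (fun u hu => Du u i (lt_trans (ltrN10 _) (proj1 (elimT andP hu))))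
  (fun u _ => is_derive_expR_scale _ _ u).
rewrite /= !sol0 subrr !mxE subr0 => H; apply: le_trans.
  apply: H => u /andP[u0 _].
  apply: le_trans (mx_norm_entry _ _ _) _; apply: le_trans (fL _ _) _.
  have -> : K / 2 * (2 * L * expR (2 * L * u)) = L * (K * expR (2 * L * u)).
    by field.
  by rewrite ler_pM2l//; have := h u; rewrite /w clip_id// ltW.
by rewrite gerBl mulr_ge0 ?expR_ge0// divr_ge0.
Qed.

Let X k := iter k step (cst x0).

Let X_lip k s t : `|X k s - X k t| <= M * `|s - t|.
Proof.
elim: k s t => [|k IH] s t; first by rewrite subrr normr0 mulr_ge0.
by apply: step_lip; exact: lipschitz_continuous IH.
Qed.

Let X_cont k : continuous (X k) := lipschitz_continuous (X_lip k).

(* For [t >= 0], [|X 1 t - X 0 t| <= M * t] and [2 * L * t <= expR (2 * L * t)]. *)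
Let K0 := M / (2 * L).

Let K0_ge0 : 0 <= K0. Proof. by rewrite divr_ge0// mulr_ge0// ltW. Qed.

Let X_succ k t : `|X k.+1 t - X k t| <= K0 * 2^-1 ^+ k * w t.
Proof.
elim: k t => [|k IH] t.
  rewrite expr0 mulr1; have -> : X 0 t = X 1 0.
    by rewrite /X/= /step /clip maxxx sol0.
  have -> : X 1 t = X 1 (clip t) by rewrite /X/= /step (clip_id (clip_ge0 t)).
  apply: le_trans (X_lip 1 _ 0) _; rewrite subr0 ger0_norm// /w.
  have := expR_ge1Dx (2 * L * clip t) => h.
  have -> : M * clip t = K0 * (2 * L * clip t) by rewrite /K0; field; exact: lt0r_neq0.
  by rewrite ler_wpM2l//; lra.
have -> : K0 * 2^-1 ^+ k.+1 = K0 * 2^-1 ^+ k / 2 by rewrite exprSr mulrA.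
exact: (step_contract (@X_cont k.+1) (@X_cont k) IH t).
Qed.

Let X_far k j t :
  `|X (k + j) t - X k t| <= 2 * K0 * (2^-1 ^+ k - 2^-1 ^+ (k + j)) * w t.
Proof.
elim: j => [|j IH]; first by rewrite addn0 !subrr normr0 mulr0 mul0r.
rewrite addnS -(subrKA (X (k + j) t)); apply: le_trans (ler_normD _ _) _.
apply: le_trans (lerD (X_succ _ _) IH) _; rewrite exprSr.
rewrite -mulrDl ler_pM2r ?expR_gt0//; set a := _ ^+ k; set b := _ ^+ _; lra.
Qed.

Let w_gt0 t : 0 < w t. Proof. exact: expR_gt0. Qed.

Let X_tail k j t : `|X (k + j) t - X k t| <= 2 * K0 * w t * 2^-1 ^+ k.
Proof.
apply: le_trans (X_far k j t) _; rewrite mulrAC.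
apply: ler_wpM2l; first by apply: mulr_ge0; [exact: mulr_ge0|exact: ltW].
by rewrite gerBl exprn_ge0// invr_ge0.
Qed.

Let X_cvg t : cvg ((X k t) @[k --> \oo]).
Proof.
apply/cauchy_cvgP/cauchy_exP => e e0.
have : geometric (2 * K0 * w t) (2^-1 : R) @ \oo --> (0 : R).
  by apply: cvg_geometric; rewrite ger0_norm ?invr_ge0// invf_lt1// ltr1n.
move=> /cvgrPdist_lt/(_ _ e0)[k _ /(_ k (leqnn _))].
rewrite /= sub0r normrN => hk; exists (X k t); exists k => // j /= kj.
rewrite -ball_normE /= distrC -(subnKC kj).
by apply: le_lt_trans (X_tail _ _ _) _; apply: le_lt_trans hk; exact: ler_norm.
Qed.

Let Y t := lim ((X k t) @[k --> \oo]).

Let Y_dist k t : `|Y t - X k t| <= 2 * K0 * w t * 2^-1 ^+ k.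
Proof.
have cv : `|X j t - X k t| @[j --> \oo] --> `|Y t - X k t|.
  by apply: cvg_norm; apply: cvgB; [exact: X_cvg|exact: cvg_cst].
rewrite -(cvg_lim _ cv)//; apply: limr_le; first by apply/cvg_ex; eexists; exact: cv.
by exists k => // j /= kj; rewrite -(subnKC kj).
Qed.

(* All iterates are [M]-Lipschitz because [f] is bounded by [M]; this passes
   to the pointwise limit and makes it continuous. *)
Let Y_lip s t : `|Y s - Y t| <= M * `|s - t|.
Proof.
rewrite -subr_le0; apply: (@le0_geometric _ _ (2 * K0 * (w s + w t))) => k.
have := Y_dist k s; have := Y_dist k t; have := X_lip k s t.
have -> : Y s - Y t = (Y s - X k s) + (X k s - X k t) + (X k t - Y t).
  by rewrite -addrA !subrKA.
have := ler_normD (Y s - X k s + (X k s - X k t)) (X k t - Y t).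
have := ler_normD (Y s - X k s) (X k s - X k t).
rewrite (distrC (X k t)) mulrDr mulrDl; lra.
Qed.

Let Y_cont : continuous Y := lipschitz_continuous Y_lip.

Let Y_fix t : step Y t = Y t.
Proof.
apply/eqP; rewrite -subr_eq0 -normr_le0.
apply: (@le0_geometric _ _ (2 * K0 * w t)) => k.
rewrite -(subrKA (X k.+1 t)); apply: le_trans (ler_normD _ _) _.
have h u : `|Y u - X k u| <= 2 * K0 * 2^-1 ^+ k * w u.
  by rewrite mulrAC; exact: Y_dist.
have := step_contract Y_cont (@X_cont k) h t; rewrite -/(X k.+1).
have := Y_dist k.+1 t; rewrite distrC exprSr.
rewrite [step (X k) t]/(X k.+1 t) => h1 h2.
apply: le_trans (lerD h2 h1) _.
by rewrite le_eqVlt; apply/orP; left; apply/eqP; field.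
Qed.

Lemma picard_lindelof : exists x : R -> 'cV[R]_m,
  x 0 = x0 /\ forall t : R, 0 <= t -> is_derive t 1 x (f (x t)).
Proof.
exists (sol Y); split; first exact: sol0.
move=> t t0; have -> : sol Y t = Y t by rewrite -Y_fix /step clip_id.
by apply: sol_derive; [exact: Y_cont|lra].
Qed.

End Picard.

(** * Exponential convergence from a Lyapunov function *)

Section Lyapunov.
Variable R : realType.

(** The set of times where [g] reaches [c] is compact, and its least element is
    the first one. *)
Lemma first_hit (g : R -> R) (T c : R) : continuous g -> 0 <= T -> c <= g T ->
  exists S, [/\ 0 <= S, c <= g S & forall s, 0 <= s < S -> g s < c].
Proof.
move=> cg T0 cT.
pose A := `[0, T] `&` (g @^-1` [set y | c <= y]).
have cA : compact A.
  apply: (@subclosed_compact _ _ `[0, T]); last by move=> y [].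
    apply: closedI; first exact: interval_closed.
    by apply: preimage_closed => [y _|]; [exact: cg|exact: closed_ge].
  exact: segment_compact.
have A0 : A !=set0 by exists T; split => //=; rewrite in_itv/= T0 lexx.
have cid : {within A, continuous (@id R)}.
  by apply: continuous_subspaceT => y; exact: cvg_id.
have [S] := compact_EVT_min A0 cA cid.
rewrite inE => -[/=]; rewrite in_itv/= => /andP[S0 ST] cS Smin.
exists S; split => // s /andP[s0 sS]; rewrite ltNge; apply/negP => cs.
have := Smin s; rewrite leNgt sS inE => /(_ _)/notF; apply; split => //=.
by rewrite in_itv/= s0 (le_trans (ltW sS)).
Qed.

Lemma trajectory_of_is_derive m (f : 'cV[R]_m -> 'cV[R]_m) (x : R -> 'cV[R]_m) :
  (forall t : R, 0 <= t -> is_derive t 1 x (f (x t))) -> trajectory f x.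
Proof.
move=> xD; split=> [t t0|]; first by apply: xD; exact: ltW.
have [dr <-] := xD 0 (lexx _).
have := cvg_dnbhs_at_right dr; apply: cvg_trans; apply: near_eq_cvg.
by apply: nearW => h /=; rewrite [_ *: 1]mulr1 addr0.
Qed.

(** Extending a trajectory by its initial value turns the one-sided
    differentiability at 0 into continuity on the whole line. *)
Lemma trajectory_clip m (f : 'cV[R]_m -> 'cV[R]_m) (x : R -> 'cV[R]_m) :
  trajectory f x -> continuous (fun t : R => x (Num.max t 0)).
Proof.
move=> [Dx x0]; suff cx (t : R) : x (Num.max s 0) @[s --> t] --> x (Num.max t 0).
  by move=> t; exact: cx.
have [t0|t0|->] := ltgtP t 0.
- have H : cst (x 0) s @[s --> t] --> x 0 by exact: cvg_cst.
  apply: cvg_trans H.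
  apply: near_eq_cvg; near=> s; rewrite /cst max_r// ltW//.
  by near: s; exact: lt_nbhsl.
- have cx : {for t, continuous x}.
    apply/differentiable_continuous/derivable1_diffP.
    by have D := Dx _ t0; exact: ex_derive.
  apply: cvg_trans cx.
  apply: near_eq_cvg; near=> s; rewrite max_l// ltW//.
  by near: s; exact: lt_nbhsr.
- have E : x (Num.max 0 0) = x 0 by rewrite maxxx.
  rewrite -E; apply/(left_right_continuousP (fun s : R => x (Num.max s 0)) 0).
  rewrite E; split.
    have H : cst (x 0) s @[s --> (0 : R)^'-] --> x 0 by exact: cvg_cst.
    apply: cvg_trans H.
    by apply: near_eq_cvg; near=> s; rewrite /cst max_r// ltW.
  have : x 0 + h *: (h^-1 *: (x h - x 0)) @[h --> 0^'+] --> x 0 + 0 *: f (x 0).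
    apply: cvgD; first exact: cvg_cst.
    by apply: cvgZ => //; apply: cvg_at_right_filter; exact: cvg_id.
  rewrite scale0r addr0; apply: cvg_trans; apply: near_eq_cvg; near=> s.
  have s0 : 0 < s by [].
  by rewrite max_l ?ltW// scalerA divff ?lt0r_neq0// scale1r addrC subrK.
Unshelve. all: by end_near. Qed.

Lemma trajectory_clip_derive m (f : 'cV[R]_m -> 'cV[R]_m)
    (x : R -> 'cV[R]_m) (t : R) :
  trajectory f x -> 0 < t ->
  is_derive t 1 (fun t : R => x (Num.max t 0)) (f (x t)).
Proof.
move=> [Dx _] t0; apply: near_eq_is_derive (Dx t t0); near=> s.
rewrite max_l// ltW//; near: s; exact: lt_nbhsr.
Unshelve. all: by end_near. Qed.

(** The hypotheses on [f] are only made on the ball, so that the same lemma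
    serves for the original field and for its modification outside the ball;
    that the trajectory stays in the ball is part of the conclusion. *)
Section Decay.
Variables (m : nat) (f : 'cV[R]_m -> 'cV[R]_m) (p : 'cV[R]_m).
Variables (V : 'cV[R]_m -> R) (dV : 'cV[R]_m -> 'cV[R]_m -> R).
Variables (delta c C : R).
Hypothesis delta0 : 0 < delta.
Hypothesis c0 : 0 < c.
Hypothesis C0 : 0 <= C.
Hypothesis V_cont : continuous V.
Hypothesis V_ge0 : forall x, 0 <= V x.
Hypothesis V_chain : forall (y : R -> 'cV[R]_m) (t : R) dy,
  is_derive t 1 y dy -> is_derive t 1 (V \o y) (dV (y t) dy).
Hypothesis V_decr : forall x, `|x - p| < delta -> dV x (f x) <= - (2 * c) * V x.
Hypothesis f_le : forall x, `|x - p| < delta -> `|f x| <= C * Num.sqrt (V x).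

Variable x : R -> 'cV[R]_m.
Hypothesis x_traj : trajectory f x.
Hypothesis x0_near : `|x 0 - p| < delta / 2.
Hypothesis Vx0_small : C * Num.sqrt (V (x 0)) <= c * (delta / 2).

Let X (t : R) := x (Num.max t 0).

Let X_pos (t : R) : 0 <= t -> X t = x t.
Proof. by move=> t0; rewrite /X max_l. Qed.

Let X_cont : continuous X := trajectory_clip x_traj.

Let X_derive (t : R) : 0 < t -> is_derive t 1 X (f (X t)).
Proof. by move=> t0; rewrite X_pos ?ltW//; exact: trajectory_clip_derive. Qed.

Let inside T := forall t : R, 0 < t < T -> `|X t - p| < delta.

Let V_decay T : inside T -> forall t : R, 0 <= t <= T ->
  V (X t) <= V (X 0) * expR (- (2 * c) * t).
Proof.
move=> XT t /andP[t0 tT].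
pose W s := V (X s) * expR (2 * c * s).
have DW (s : R) : 0 < s < t ->
    is_derive s 1 W (dV (X s) (f (X s)) * expR (2 * c * s) +
                     V (X s) * (2 * c * expR (2 * c * s))).
  move=> /andP[s0 st]; have D1 := V_chain (X_derive s0).
  have D2 := is_derive_expR_scale 1 (2 * c) s.
  have : is_derive s 1 ((V \o X) * (fun s : R => 1 * expR (2 * c * s)))
    (V (X s) *: (1 * (2 * c * expR (2 * c * s))) +
     (1 * expR (2 * c * s)) *: (dV (X s) (f (X s)))).
    exact: is_deriveM.
  rewrite /GRing.scale/= !mul1r addrC [_ * dV _ _]mulrC.
  rewrite [_ * _](_ : _ = W)//; apply/funext => r.
  by rewrite /W -[in RHS](mul1r (expR _)).
have cW : {within `[0, t], continuous W}.
  apply: continuous_subspaceT => s; rewrite /W.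
  apply: cvgM.
    by apply: (@continuous_comp _ _ _ X V); [exact: X_cont|exact: V_cont].
  by have := @expR_scale_continuous R 1 (2 * c) s; under eq_fun do rewrite mul1r.
have ccst : {within `[0, t], continuous (cst (0 : R))}.
  by apply: continuous_subspaceT => s; exact: cvg_cst.
have := increment_le t0 cW ccst DW (fun s _ => is_derive_cst (0 : R) s 1).
have H s : 0 < s < t -> dV (X s) (f (X s)) * expR (2 * c * s) +
    V (X s) * (2 * c * expR (2 * c * s)) <= 0.
  move=> /andP[s0 st]; rewrite mulrA -mulrDl pmulr_lle0 ?expR_gt0//.
  have := V_decr (XT s _); rewrite s0 (lt_le_trans st tT) => /(_ isT); lra.
move=> /(_ H); rewrite subrr subr_le0 /W mulr0 expR0 mulr1.
by rewrite mulNr expRN ler_pdivlMr ?expR_gt0.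
Qed.

(* The speed is at most [C * sqrt (V (x 0)) * expR (- c * t)], hence at most
   the derivative of [- (delta / 2) * expR (- c * t)]. *)
Let X_increment T : inside T -> forall a b : R, 0 <= a <= b -> b <= T ->
  `|X b - X a| <= delta / 2 * expR (- c * a).
Proof.
move=> XT a b /andP[a0 ab] bT; pose v := Num.sqrt (V (x 0)).
apply: (@le_trans _ _
  (- (delta / 2) * expR (- c * b) - - (delta / 2) * expR (- c * a))); last first.
  by rewrite !mulNr opprK gerDr oppr_le0 mulr_ge0 ?expR_ge0// divr_ge0// ltW.
apply/mx_norm_leP => [|i j].
  rewrite !mulNr opprK addrC subr_ge0 ler_pM2l ?divr_gt0// ler_expR.
  by rewrite lerNl opprK ler_pM2l.
rewrite (ord1 j) !mxE.
apply: (@norm_increment_le _ (fun s => X s i 0) (fun s => f (X s) i 0)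
  (fun s => - (delta / 2) * expR (- c * s))
  (fun s => - (delta / 2) * (- c * expR (- c * s))) _ _ ab).
- apply: continuous_subspaceT => s.
  apply: (@continuous_comp _ _ _ X (fun z : 'cV[R]_m => z i 0)); first exact: X_cont.
  exact: coord_continuous.
- by apply: continuous_subspaceT; exact: expR_scale_continuous.
- move=> s /andP[sa sb]; apply: is_derive_entry; apply: X_derive; lra.
- by move=> s _; exact: is_derive_expR_scale.
move=> s /andP[sa sb]; apply: le_trans (mx_norm_entry _ _ _) _.
have s0 : 0 < s by lra.
have sT : s < T by lra.
apply: (le_trans (f_le (XT _ _))); first by rewrite s0.
apply: (@le_trans _ _ (C * v * expR (- c * s))).
  rewrite -mulrA ler_wpM2l// /v -X_pos//.
  rewrite -[expR _]ger0_norm ?expR_ge0// -sqrtr_sqr -sqrtrM// ler_wsqrtr//.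
  rewrite expr2 -expRD -mulrDl -opprD -mulr2n -mulr_natl.
  by apply: (V_decay XT); rewrite !ltW.
set E := expR _; have -> : - (delta / 2) * (- c * E) = c * (delta / 2) * E by ring.
by rewrite ler_pM2r ?expR_gt0.
Qed.

(* Until the first time on the sphere of radius [delta] the displacement is at
   most [delta / 2], and the initial distance is less than [delta / 2]. *)
Let always_inside t : 0 <= t -> `|X t - p| < delta.
Proof.
move=> t0; rewrite ltNge; apply/negP => ht.
have cg : continuous (fun s => `|X s - p|).
  move=> s; apply: cvg_norm; apply: cvgB; [exact: X_cont|exact: cvg_cst].
have [S [S0 hS Slt]] := first_hit cg t0 ht.
have XS : inside S by move=> s /andP[s0 sS]; apply: Slt; rewrite ltW.
have := X_increment XS (a := 0) (b := S); rewrite S0 !lexx => /(_ isT isT).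
rewrite mulr0 expR0 mulr1 => h1.
have := ler_normD (X S - X 0) (X 0 - p); rewrite subrKA [X 0]X_pos// => h2.
have : `|X S - p| < delta.
  by move: h1 (x0_near); rewrite [X 0]X_pos// => h1 h3; lra.
by rewrite ltNge hS.
Qed.

Lemma lyapunov_decay :
  (forall t, 0 <= t -> `|x t - p| < delta) /\
  exists q, V q = 0 /\
    forall t, 0 <= t -> `|q - x t| <= delta * expR (- (c * t)).
Proof.
split=> [t t0|]; first by rewrite -X_pos//; exact: always_inside.
have ins T : inside T by move=> t /andP[/ltW t0 _]; exact: always_inside.
have incr (a b : R) : 0 <= a <= b -> `|X b - X a| <= delta / 2 * expR (- c * a).
  by move=> ab; exact: (X_increment (ins b)).
have e1 : `|expR (- c)| < 1.
  by rewrite ger0_norm ?expR_ge0// expR_lt1 oppr_lt0.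
have cvX : cvg ((X n%:R) @[n --> \oo]).
  apply/cauchy_cvgP/cauchy_exP => e e0.
  have /cvgrPdist_lt/(_ _ e0)[k _ /(_ k (leqnn _))] := @cvg_geometric _ (delta / 2) _ e1.
  rewrite /= sub0r normrN => hk; exists (X k%:R); exists k => // j /= kj.
  rewrite -ball_normE /= distrC; apply: le_lt_trans (incr _ _ _) _.
    by rewrite ler0n ler_nat.
  by apply: le_lt_trans hk; rewrite expRM_natr; exact: ler_norm.
pose q := lim ((X n%:R) @[n --> \oo]).
exists q; split.
  apply/eqP; rewrite eq_le V_ge0 andbT.
  have cvV : V (X n%:R) @[n --> \oo] --> V q.
    by apply: (cvg_comp _ _ cvX); exact: V_cont.
  have e2 : `|expR (- (2 * c))| < 1.
    by rewrite ger0_norm ?expR_ge0// expR_lt1 oppr_lt0 mulr_gt0.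
  apply: (ler_cvg_to cvV (@cvg_geometric _ (V (X 0)) _ e2)).
  apply: nearW => k /=; rewrite -expRM_natr.
  by apply: (V_decay (ins k%:R)); rewrite ler0n lexx.
move=> t t0; rewrite -X_pos//.
have cv : `|X n%:R - X t| @[n --> \oo] --> `|q - X t|.
  by apply: cvg_norm; apply: cvgB; [exact: cvX|exact: cvg_cst].
rewrite -(cvg_lim _ cv)//; apply: limr_le; first by apply/cvg_ex; eexists; exact: cv.
near=> k; apply: le_trans (incr _ _ _) _.
  by rewrite t0 /= ltW//; near: k; exact: nbhs_infty_gtr.
by rewrite mulNr ler_pM2r ?expR_gt0//; move: delta0 => d0; lra.
Unshelve. all: by end_near. Qed.

End Decay.

End Lyapunov.

(** * Maps that are Lipschitz on bounded sets *)

Section LocallyLipschitz.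
Variable R : realType.

(** Boundedness is included to make the property stable under products, so that
    it holds for all maps with polynomial entries; it gives at once their
    continuity and the constants needed to solve differential equations. *)
Definition lip_on_bounded (U W : normedModType R) (g : U -> W) :=
  forall r : R, exists2 K : R, 0 <= K & forall x y, `|x| <= r -> `|y| <= r ->
    `|g x| <= K /\ `|g x - g y| <= K * `|x - y|.

Lemma lip_on_bounded_continuous (U W : normedModType R) (g : U -> W) :
  lip_on_bounded g -> continuous g.
Proof.
move=> gl x; have [K K0 gK] := gl (`|x| + 1).
apply/cvgrPdist_le => e e0; apply/nbhs_normP.
have K1 : 0 < K + 1 by rewrite ltr_pwDr.
exists (Num.min 1 (e / (K + 1))) => [|y] /=.
  by rewrite lt_min ltr01 divr_gt0.
rewrite lt_min => /andP[xy1 /ltW xye].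
have xr : `|x| <= `|x| + 1 by rewrite lerDl.
have yr : `|y| <= `|x| + 1.
  rewrite -[y](subrK x); apply: le_trans (ler_normD _ _) _.
  by rewrite addrC lerD2l distrC ltW.
have [_] := gK _ _ xr yr; move=> /le_trans; apply.
rewrite ler_pdivlMr// in xye; apply: le_trans xye.
by rewrite mulrC ler_wpM2l// lerDl.
Qed.

Lemma continuous_near_dist (U W : normedModType R) (g : U -> W) (x : U) (e : R) :
  continuous g -> 0 < e -> \forall y \near x, `|g x - g y| < e.
Proof. by move=> gc e0; have /cvgrPdist_lt := gc x; apply. Qed.

Lemma lip_on_bounded_cst (U W : normedModType R) (w : W) :
  lip_on_bounded (fun _ : U => w).
Proof. by move=> r; exists `|w| => // x y _ _; rewrite subrr normr0 mulr_ge0. Qed.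

Lemma lip_on_boundedD (U W : normedModType R) (g h : U -> W) :
  lip_on_bounded g -> lip_on_bounded h -> lip_on_bounded (fun x => g x + h x).
Proof.
move=> gl hl r; have [K K0 gK] := gl r; have [H H0 hH] := hl r.
exists (K + H) => [|x y xr yr]; first exact: addr_ge0.
have [g1 g2] := gK _ _ xr yr; have [h1 h2] := hH _ _ xr yr; split.
  by apply: le_trans (ler_normD _ _) _; exact: lerD.
rewrite opprD addrACA mulrDl; apply: le_trans (ler_normD _ _) _; exact: lerD.
Qed.

Lemma lip_on_boundedN (U W : normedModType R) (g : U -> W) :
  lip_on_bounded g -> lip_on_bounded (fun x => - g x).
Proof.
move=> gl r; have [K K0 gK] := gl r; exists K => // x y xr yr.
by rewrite normrN -opprD normrN; exact: gK.
Qed.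

Lemma lip_on_bounded_tr (U : normedModType R) a b (g : U -> 'M[R]_(a, b)) :
  lip_on_bounded g -> lip_on_bounded (fun x => (g x)^T).
Proof.
move=> gl r; have [K K0 gK] := gl r; exists K => // x y xr yr.
by rewrite mx_norm_tr -linearB/= mx_norm_tr; exact: gK.
Qed.

Lemma lip_on_bounded_mulmx (U : normedModType R) a b k
    (g : U -> 'M[R]_(a, b)) (h : U -> 'M[R]_(b, k)) :
  lip_on_bounded g -> lip_on_bounded h -> lip_on_bounded (fun x => g x *m h x).
Proof.
move=> gl hl r; have [K K0 gK] := gl r; have [H H0 hH] := hl r.
exists (b%:R * K * H + b%:R * K * H) => [|x y xr yr].
  by rewrite addr_ge0// !mulr_ge0.
have [g1 g2] := gK _ _ xr yr; have [h1 h2] := hH _ _ xr yr.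
have [gy _] := gK _ _ yr xr; split.
  apply: (le_trans (mx_norm_mulmx _ _)); apply: (@le_trans _ _ (b%:R * K * H)).
    by rewrite ler_pM// ?mulr_ge0// ler_wpM2l.
  by rewrite lerDl !mulr_ge0.
have -> : g x *m h x - g y *m h y = (g x - g y) *m h x + g y *m (h x - h y).
  by rewrite mulmxBl mulmxBr subrKA.
apply: le_trans (ler_normD _ _) _; rewrite mulrDl; apply: lerD.
  have -> : b%:R * K * H * `|x - y| = b%:R * (K * `|x - y|) * H by ring.
  apply: (le_trans (mx_norm_mulmx _ _)).
  by apply: ler_pM; rewrite ?mulr_ge0// ler_wpM2l.
rewrite -[b%:R * K * H * _]mulrA; apply: (le_trans (mx_norm_mulmx _ _)).
by apply: ler_pM; rewrite ?mulr_ge0// ler_wpM2l.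
Qed.

Lemma lip_on_bounded_linear k a b (g : {linear 'cV[R]_k -> 'M[R]_(a, b)}) :
  lip_on_bounded g.
Proof.
pose K := \sum_i `|g (delta_mx i 0)|.
have K0 : 0 <= K by apply: sumr_ge0.
have gK x : `|g x| <= K * `|x|.
  have -> : g x = \sum_i x i 0 *: g (delta_mx i 0).
    rewrite {1}[x]matrix_sum_delta linear_sum; apply: eq_bigr => i _.
    by rewrite linear_sum big_ord1 linearZ.
  apply: le_trans (ler_norm_sum _ _ _) _; rewrite mulr_suml; apply: ler_sum => i _.
  by rewrite normrZ mulrC ler_wpM2l// mx_norm_entry.
move=> r; exists (K * `|r| + K) => [|x y xr yr]; first by rewrite addr_ge0// mulr_ge0.
split; last first.
  rewrite -linearB; apply: (le_trans (gK _)); rewrite ler_wpM2r// lerDr mulr_ge0//.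
apply: (le_trans (gK _)); apply: ler_wpDr => //; rewrite ler_wpM2l//.
exact: le_trans xr (ler_norm _).
Qed.

End LocallyLipschitz.

(** * Quadratic forms positive on a kernel *)

Section Coercivity.
Variable R : realType.

Definition quad N (Z : 'M[R]_N) (y : 'cV[R]_N) : R := (y^T *m Z *m y) 0 0.

Lemma quadZ N (Z : 'M[R]_N) (y : 'cV[R]_N) a : quad Z (a *: y) = a ^+ 2 * quad Z y.
Proof.
by rewrite /quad [(a *: y)^T]linearZ/= -scalemxAr -!scalemxAl scalerA mxE expr2.
Qed.

(** On the unit sphere [Num.max (quad Z y) `|G *m y|] is continuous and positive:
    where its second argument vanishes the first one is positive.  Half of its
    minimum is the constant, and homogeneity does the rest. *)
Lemma quad_coercive N k (Z : 'M[R]_N) (G : 'M[R]_(k, N)) :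
  (forall y : 'cV_N, y != 0 -> G *m y = 0 -> 0 < quad Z y) ->
  exists2 c, 0 < c &
    forall y : 'cV_N, `|G *m y| <= c * `|y| -> c * `|y| ^+ 2 <= quad Z y.
Proof.
move=> Zpos.
pose h (u : 'rV[R]_N) := Num.max (quad Z u^T) `|G *m u^T|.
pose S := [set u : 'rV[R]_N | `|u| = 1].
have id_lip : lip_on_bounded (@id 'rV[R]_N).
  move=> r; exists (`|r| + 1) => [|x y xr _]; first by rewrite addr_ge0.
  split; first by rewrite ler_wpDr// (le_trans xr)// ler_norm.
  by rewrite ler_peMl// lerDr.
have tr_lip := lip_on_bounded_tr id_lip.
have ch : continuous h.
  have c1 : continuous (fun u : 'rV[R]_N => quad Z u^T).
    move=> u; apply: (@continuous_comp _ _ _ (fun u : 'rV[R]_N => u^T^T *m Z *m u^T)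
      (fun A : 'M[R]_(1, 1) => A 0 0)); last exact: coord_continuous.
    apply: lip_on_bounded_continuous; apply: lip_on_bounded_mulmx => //.
    apply: lip_on_bounded_mulmx; last exact: lip_on_bounded_cst.
    exact: lip_on_bounded_tr.
  have c2 : continuous (fun u : 'rV[R]_N => `|G *m u^T|).
    move=> u; apply: (@continuous_comp _ _ _ (fun u : 'rV[R]_N => G *m u^T) Num.norm).
      apply: lip_on_bounded_continuous; apply: lip_on_bounded_mulmx => //.
      exact: lip_on_bounded_cst.
    exact: norm_continuous.
  by move=> u; have := continuous_max (c1 u) (c2 u).
have [u0|noS] := pselect (S !=set0); last first.
  exists 1 => // y _; have [->|y0] := eqVneq y 0.
    by rewrite normr0 expr0n mulr0 /quad mulmx0 mxE.
  case: noS; exists (`|y|^-1 *: y^T); rewrite /S/= normrZ mx_norm_tr.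
  by rewrite ger0_norm ?invr_ge0// mulVf// normr_eq0.
have cS : compact S.
  apply: bounded_closed_compact.
    exists 1; split; first exact: num_real.
    by move=> M M1 u; rewrite /S/= => ->; exact: ltW.
  apply: (@preimage_closed _ _ (fun u : 'rV[R]_N => `|u|) [set 1]); last exact: closed_eq.
  by move=> u _; exact: norm_continuous.
have [v] := compact_EVT_min u0 cS (continuous_subspaceT ch).
rewrite inE => v1 vmin.
have hv : 0 < h v.
  rewrite /h lt_max normr_gt0; have [G0|//] := eqVneq (G *m v^T) 0; last by rewrite orbT.
  rewrite Zpos// -normr_gt0 mx_norm_tr v1//.
exists (h v / 2) => [|y hy]; first by rewrite divr_gt0.
have [->|y0] := eqVneq y 0; first by rewrite normr0 expr0n mulr0 /quad mulmx0 mxE.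
have ny : 0 < `|y| by rewrite normr_gt0.
pose z := `|y|^-1 *: y.
have yE : y = `|y| *: z by rewrite scalerA divff ?scale1r// gt_eqF.
have z1 : `|z| = 1 by rewrite normrZ ger0_norm ?invr_ge0// mulVf// gt_eqF.
have := vmin z^T; rewrite inE /S/= mx_norm_tr => /(_ z1).
rewrite /h trmxK le_max => /orP[|] hz.
  rewrite {2}yE quadZ mulrC ler_wpM2l ?sqr_ge0//; apply: le_trans hz.
  by rewrite -/(h v) ler_pdivrMr// ler_peMr ?ler1n// ltW.
move: hy; rewrite {1}yE -scalemxAr normrZ normr_id mulrC ler_pM2r// => hy.
have := le_trans hz hy; rewrite -/(h v); lra.
Qed.

End Coercivity.

(** * The tangent space of a submanifold containing the image of a map *)

Section Slice.
Variable R : realType.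

Lemma differentiable_estimate (V W : normedModType R) (f : V -> W) (x : V) :
  differentiable f x -> forall e : R, 0 < e ->
  \forall y \near x, `|f y - f x - 'd f x (y - x)| <= e * `|y - x|.
Proof.
move=> df e e0; have /eqaddoP/(_ e e0) := diff_locally df.
rewrite (near_shift 0 x) subr0; apply: filterS => z.
rewrite -[X in `|X| <= _]/(f (z + x) - (f x + 'd f x z)) /= addrK.
by rewrite opprD addrA.
Qed.

Definition jacobian_cV N k (phi : 'cV[R]_N -> 'cV[R]_k) (y : 'cV[R]_N) : 'M[R]_(k, N) :=
  \matrix_(i, j) 'd phi y (delta_mx j 0) i 0.

Lemma jacobian_cVE N k (phi : 'cV[R]_N -> 'cV[R]_k) y v :
  'd phi y v = jacobian_cV phi y *m v.
Proof.
rewrite {1}[v]matrix_sum_delta linear_sum; apply/colP => i; rewrite mxE summxE.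
apply: eq_bigr => j _; rewrite linear_sum big_ord1 linearZ [LHS]mxE mulrC.
by rewrite [X in _ = X * _]mxE.
Qed.

Lemma jacobian_cV_unit N (phi psi : 'cV[R]_N -> 'cV[R]_N) y :
  differentiable phi y -> differentiable psi (phi y) ->
  (\near y, psi (phi y) = y) -> jacobian_cV phi y \in unitmx.
Proof.
move=> dphi dpsi inv.
suff : jacobian_cV psi (phi y) *m jacobian_cV phi y = 1%:M by move=> /mulmx1_unit[].
suff h v : jacobian_cV psi (phi y) *m jacobian_cV phi y *m v = v :> 'cV[R]_N.
  apply/matrixP => i j; have := h (delta_mx j 0) => /colP/(_ i).
  by rewrite -colE !mxE !eqxx andbT.
rewrite -mulmxA -!jacobian_cVE.
have := diff_comp dphi dpsi => /(congr1 (fun g => g v))/= <-.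
rewrite -deriveE; last exact: differentiable_comp.
by rewrite (@near_eq_derive _ _ _ _ id)// derive_id.
Qed.

Lemma copid_mx_mulE N r (v : 'cV[R]_N) (i : 'I_N) :
  (copid_mx r *m v) i 0 = if (r <= i)%N then v i 0 else 0.
Proof.
rewrite mxE (bigD1 i)//= big1 => [|k ki]; last first.
  by rewrite !mxE eq_sym (negbTE ki) val_eqE eq_sym (negbTE ki) subrr mul0r.
by rewrite !mxE !eqxx addr0; case: leqP => _; rewrite ?subr0 ?mul1r// subrr mul0r.
Qed.

(** If the derivative of [F] at [x0] has the dimension of [M] as its rank, the
    chart gives a linearised equation [G] of [M] at [F x0] whose solutions are
    the range of that derivative.  [G] consists of the rows of index at least [r]
    of the derivative of the chart: it has rank [N - r] since the chart is
    invertible, and it kills the derivative of [F] since these coordinates of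
    the chart vanish along [F]; equality of dimensions concludes. *)
Lemma submanifold_tangent N m r (M : set 'cV[R]_N) (F : 'cV[R]_m -> 'cV[R]_N)
    (x0 : 'cV[R]_m) (A : 'M[R]_(N, m)) :
  embedded_submanifold_near r M (F x0) -> (forall x, M (F x)) ->
  {for x0, continuous F} ->
  (forall h, is_derive x0 h F (A *m h)) -> \rank A = r ->
  exists G : 'M[R]_N,
    (forall y : 'cV[R]_N, G *m y = 0 -> exists h, y = A *m h) /\
    (forall e : R, 0 < e ->
      \forall x \near x0, `|G *m (F x - F x0)| <= e * `|F x - F x0|).
Proof.
case=> O [oO Oy0 [rN charts]] MF cF dF rA.
have [U [W [phi [psi [Uy0 [[oU oW] [sphi spsi] phiK _] slice]]]]] :=
  charts _ (conj (MF x0) Oy0).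
have [Wphi _] := phiK _ Uy0.
have dphi : differentiable phi (F x0) by have [h _] := sphi 1%N; exact: h.
have dpsi : differentiable psi (phi (F x0)) by have [h _] := spsi 1%N; exact: h.
have Ju : jacobian_cV phi (F x0) \in unitmx.
  apply: (jacobian_cV_unit dphi dpsi); near=> y; apply: (proj2 (phiK y _)).
  by near: y; exact: open_nbhs_nbhs.
pose G : 'M[R]_N := copid_mx r *m jacobian_cV phi (F x0).
have E0 x : (M `&` O) x -> U x -> copid_mx r *m phi x = 0 :> 'cV[R]_N.
  move=> Mx Ux; have /(slice _ Ux) h := Mx.
  by apply/colP => i; rewrite copid_mx_mulE mxE; case: leqP => // ri; exact: h.
have Gest (e : R) : 0 < e ->
    \forall x \near x0, `|G *m (F x - F x0)| <= e * `|F x - F x0|.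
  move=> e0.
  have est : \forall x \near x0, `|phi (F x) - phi (F x0) - 'd phi (F x0) (F x - F x0)|
      <= e * `|F x - F x0|.
    exact: (cF _ (differentiable_estimate dphi e0)).
  have FU : \forall x \near x0, U (F x) by apply: cF; exact: open_nbhs_nbhs.
  have FO : \forall x \near x0, O (F x) by apply: cF; exact: open_nbhs_nbhs.
  apply: (@filterS _ _ (nbhs_filter x0) _ _ _ (filterI est (filterI FU FO))).
  move=> x [h [Ux Ox]]; apply: le_trans h.
  rewrite /G -mulmxA -jacobian_cVE.
  (* [copid_mx r] erases both values of [phi], so only the remainder [v] is left. *)
  set v := _ - _ - _.
  have -> : copid_mx r *m 'd phi (F x0) (F x - F x0) = - (copid_mx r *m v).
    by rewrite /v !mulmxBr (E0 _ _ Ux)// E0// subrr sub0r opprK.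
  rewrite normrN; apply/mx_norm_leP => // i j; rewrite (ord1 j) copid_mx_mulE.
  by case: ifP => _; [exact: mx_norm_entry|rewrite normr0].
exists G; split => //.
have GA (h : 'cV[R]_m) : G *m (A *m h) = 0.
  apply/eqP; rewrite -normr_le0; apply: (@le0_geometric _ _ `|A *m h|) => k.
  have e0 : 0 < (2^-1 : R) ^+ k by rewrite exprn_gt0// invr_gt0.
  pose q t : 'cV[R]_N := t^-1 *: (F (t *: h + x0) - F x0).
  have cq : q t @[t --> (0 : R)^'] --> A *m h.
    have [dr <-] := dF h; exact: dr.
  have cline : (t *: h + x0) @[t --> (0 : R)] --> x0.
    have : (t *: h + x0) @[t --> (0 : R)] --> 0 *: h + x0.
      apply: cvgD; last exact: cvg_cst.
      by apply: cvgZ; [exact: cvg_id|exact: cvg_cst].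
    by rewrite scale0r add0r.
  have near0 := nbhs_dnbhs (cline _ (Gest _ e0)).
  have cGq : `|G *m q t| @[t --> (0 : R)^'] --> `|G *m (A *m h)|.
    have cG : continuous (fun y : 'cV[R]_N => `|G *m y|).
      move=> y; apply: (@continuous_comp _ _ _ (fun y : 'cV[R]_N => G *m y) Num.norm).
        exact: (lip_on_bounded_continuous (lip_on_bounded_linear (mulmx G))).
      exact: norm_continuous.
    exact: (cvg_comp _ _ cq (cG (A *m h))).
  have cq' : (`|q t| * 2^-1 ^+ k) @[t --> (0 : R)^'] --> `|A *m h| * 2^-1 ^+ k.
    by apply: cvgM; [exact: cvg_norm|exact: cvg_cst].
  apply: (ler_cvg_to cGq cq'); apply: filterS near0 => t /=.
  by rewrite /q -scalemxAr !normrZ -mulrA => Ht; rewrite ler_wpM2l// mulrC.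
have GA0 : G *m A = 0.
  apply/matrixP => i j; have := GA (delta_mx j 0) => /colP/(_ i).
  by rewrite mulmxA -colE !mxE.
have rG : \rank G = (N - r)%N.
  by rewrite mxrankMfree ?rank_copid_mx// row_free_unit.
have sub : (A^T <= kermx G^T)%MS.
  by apply/sub_kermxP; rewrite -trmx_mul GA0 trmx0.
have rk : \rank (kermx G^T) = r.
  by rewrite mxrank_ker mxrank_tr rG subKn.
have [_ /esym] := mxrank_leqif_sup sub; rewrite rk mxrank_tr rA eqxx => sup.
move=> y Gy; have : (y^T <= A^T)%MS.
  by apply: submx_trans sup; apply/sub_kermxP; rewrite -trmx_mul Gy trmx0.
by case/submxP => D yD; exists D^T; rewrite -[y]trmxK yD trmx_mul trmxK.
Unshelve. all: by end_near. Qed.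
End Slice.

(** * Products and linear images of differentiable maps *)

Section CurveDerivatives.
Variable R : realType.

Lemma is_derive_mulmx (U : normedModType R) a b k (A : U -> 'M[R]_(a, b))
    (B : U -> 'M[R]_(b, k)) x v dA dB :
  is_derive x v A dA -> is_derive x v B dB ->
  is_derive x v (fun z => A z *m B z) (dA *m B x + A x *m dB).
Proof.
move=> DA DB; apply: is_derive_mx => i j.
have D l : is_derive x v ((fun z => A z i l) * (fun z => B z l j))
    (A x i l *: dB l j + B x l j *: dA i l).
  have DAl := is_derive_entry i l DA; have DBl := is_derive_entry l j DB.
  exact: is_deriveM.
have := @is_derive_sum R U R b (fun l => (fun z => A z i l) * (fun z => B z l j)) x v _ D.
congr (is_derive _ _ _ _).
  by apply/funext => z; rewrite !mxE fct_sumE.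
rewrite !mxE -big_split /=; apply: eq_bigr => l _.
by rewrite addrC /GRing.scale/= [B x l j * _]mulrC.
Qed.

Lemma is_derive_linear (U : normedModType R) k a b
    (g : {linear 'cV[R]_k -> 'M[R]_(a, b)}) (y : U -> 'cV[R]_k) x v dy :
  is_derive x v y dy -> is_derive x v (fun z => g (y z)) (g dy).
Proof.
move=> [dr dE].
have cg := lip_on_bounded_continuous (lip_on_bounded_linear g).
have H : h^-1 *: (g (y (h *: v + x)) - g (y x)) @[h --> 0^'] --> g dy.
  have : (g \o (fun h => h^-1 *: (y (h *: v + x) - y x))) h @[h --> 0^'] --> g dy.
    by rewrite -dE; apply: (cvg_comp _ _ dr); exact: cg.
  by apply: cvg_trans; apply: near_eq_cvg; apply: nearW => h /=; rewrite linearZ linearB.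
apply: DeriveDef; first by apply/cvg_ex; exists (g dy).
exact: cvg_lim H.
Qed.

End CurveDerivatives.

(** * Projection onto a box *)

Section Clamp.
Variables (R : realType) (m : nat) (p : 'cV[R]_m) (delta : R).
Hypothesis delta0 : 0 < delta.

(** A nearest-point projection onto the closed ball of the max norm; composing
    with it makes a field that is Lipschitz on bounded sets globally Lipschitz
    and bounded, without changing it on the ball. *)
Definition clamp (x : 'cV[R]_m) : 'cV[R]_m :=
  \col_i Num.max (p i 0 - delta) (Num.min (x i 0) (p i 0 + delta)).

Lemma clamp_ball x : `|clamp x - p| <= delta.
Proof.
apply/mx_norm_leP => [|i j]; first exact: ltW.
move: delta0 => d0; rewrite (ord1 j) !mxE ler_norml.
case: (leP (x i 0)) => h1; case: (leP (p i 0 - delta)) => h2; apply/andP; split; lra.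
Qed.

Lemma clamp_id x : `|x - p| <= delta -> clamp x = x.
Proof.
move=> /(mx_norm_leP _ (ltW delta0)) h; apply/colP => i; rewrite !mxE.
have := h i 0; rewrite !mxE ler_norml => /andP[h1 h2].
by rewrite min_l ?max_r//; lra.
Qed.

Lemma clamp_lip x y : `|clamp x - clamp y| <= `|x - y|.
Proof.
apply/mx_norm_leP => // i j; apply: le_trans (mx_norm_entry _ i j).
move: delta0 => d0; rewrite (ord1 j) !mxE.
have := ler_norm (x i 0 - y i 0); have := ler_norm (y i 0 - x i 0).
rewrite (distrC (y i 0)) => h1 h2; rewrite ler_norml.
by case: (leP (x i 0)) => h3; case: (leP (y i 0)) => h4;
  case: (leP (p i 0 - delta)) => h5; try case: (leP (p i 0 - delta)) => h6;
  apply/andP; split; lra.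
Qed.

End Clamp.

(** * The flow of a directed controller for quadratic measurements *)

(** [S] and [D] stand for the rigidity matrix and its directed version; the
    symmetry of [S] makes [2 *: S p] the derivative of [F] at [p]. *)
Section QuadraticMeasurement.
Variables (R : realType) (m N r : nat).
Variables S D : {linear 'cV[R]_m -> 'M[R]_(N, m)}.
Hypothesis S_sym : forall p h : 'cV[R]_m, S p *m h = S h *m p.

Let F (p : 'cV[R]_m) : 'cV[R]_N := S p *m p.

Variable pstar : 'cV[R]_m.
Let Y (p : 'cV[R]_m) : 'cV[R]_N := F p - F pstar.
Let Zmx (p : 'cV[R]_m) : 'M[R]_N := 2 *: (S p *m (D p)^T).
Let f (p : 'cV[R]_m) : 'cV[R]_m := - ((D p)^T *m Y p).

Hypothesis slice : embedded_submanifold_near r (range F) (F pstar).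
Hypothesis rank_S : \rank (S pstar) = r.
Hypothesis Z_pos : forall h : 'cV[R]_m,
  S pstar *m h != 0 -> 0 < quad (Zmx pstar) (S pstar *m h).

Let id_lip : lip_on_bounded (@id 'cV[R]_m).
Proof. exact: (lip_on_bounded_linear (@idfun 'cV[R]_m)). Qed.

Let F_lip : lip_on_bounded F.
Proof. by apply: lip_on_bounded_mulmx => //; exact: lip_on_bounded_linear. Qed.

Let Y_lip : lip_on_bounded Y.
Proof. by apply: lip_on_boundedD => //; exact: lip_on_bounded_cst. Qed.

Let f_lip : lip_on_bounded f.
Proof.
apply: lip_on_boundedN; apply: lip_on_bounded_mulmx => //.
by apply: lip_on_bounded_tr; exact: lip_on_bounded_linear.
Qed.

Let Zmx_continuous : continuous Zmx.
Proof.
apply: lip_on_bounded_continuous.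
have -> : Zmx = fun p => (2 *: S p) *m (D p)^T.
  by apply/funext => p; rewrite /Zmx scalemxAl.
apply: lip_on_bounded_mulmx; last first.
  by apply: lip_on_bounded_tr; exact: lip_on_bounded_linear.
have -> : (fun p => 2 *: S p) = (fun p => S p + S p).
  by apply/funext => p; rewrite scaler_nat mulr2n.
by apply: lip_on_boundedD; exact: lip_on_bounded_linear.
Qed.

Let F_derive (U : normedModType R) (y : U -> 'cV[R]_m) x v dy :
  is_derive x v y dy -> is_derive x v (fun z => F (y z)) ((2 *: S (y x)) *m dy).
Proof.
move=> Dy; have := is_derive_mulmx (is_derive_linear S Dy) Dy.
by rewrite [S dy *m _]S_sym scaler_nat mulr2n mulmxDl.
Qed.

Let V (p : 'cV[R]_m) : R := ((Y p)^T *m Y p) 0 0.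

Let V_sum p : V p = \sum_i Y p i 0 ^+ 2.
Proof. by rewrite /V mxE; apply: eq_bigr => i _; rewrite mxE expr2. Qed.

Let V_ge0 p : 0 <= V p.
Proof. by rewrite V_sum; apply: sumr_ge0 => i _; exact: sqr_ge0. Qed.

Let Y_le p : `|Y p| <= Num.sqrt (V p).
Proof.
apply/mx_norm_leP => [|i j]; first exact: sqrtr_ge0.
rewrite (ord1 j) -sqrtr_sqr ler_wsqrtr// V_sum (bigD1 i)//= lerDl.
by apply: sumr_ge0 => k _; exact: sqr_ge0.
Qed.

Let V_le p : V p <= N%:R * `|Y p| ^+ 2.
Proof.
rewrite V_sum -[X in _ <= X%:R * _]card_ord mulr_natl -sumr_const.
apply: ler_sum => i _; rewrite -[X in X <= _]real_normK ?num_real//.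
by rewrite lerXn2r ?nnegrE// mx_norm_entry.
Qed.

Let V_eq0 p : V p = 0 -> F p = F pstar.
Proof.
move=> Vp; apply/eqP; rewrite -subr_eq0 -normr_le0.
by have := Y_le p; rewrite Vp sqrtr0.
Qed.

Let V_continuous : continuous V.
Proof.
move=> p; apply: (@continuous_comp _ _ _ (fun p => (Y p)^T *m Y p)
  (fun A : 'M[R]_(1, 1) => A 0 0)); last exact: coord_continuous.
apply: lip_on_bounded_continuous; apply: lip_on_bounded_mulmx => //.
exact: lip_on_bounded_tr.
Qed.

Let dV (p h : 'cV[R]_m) : R := 2 * ((Y p)^T *m ((2 *: S p) *m h)) 0 0.

Let V_chain (y : R -> 'cV[R]_m) (t : R) dy :
  is_derive t 1 y dy -> is_derive t 1 (V \o y) (dV (y t) dy).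
Proof.
move=> /F_derive DF.
have DY : is_derive t 1 (fun z => Y (y z)) ((2 *: S (y t)) *m dy).
  have : is_derive t 1 ((fun z => F (y z)) - cst (F pstar)) ((2 *: S (y t)) *m dy - 0).
    exact: is_deriveB.
  by rewrite subr0.
have DYt : is_derive t 1 (fun z => (Y (y z))^T) ((2 *: S (y t)) *m dy)^T.
  exact: (is_derive_linear (@trmx R N 1) DY).
have := is_derive_entry 0 0 (is_derive_mulmx DYt DY).
rewrite /dV mulr_natl mulr2n mxE.
have -> : (((2 *: S (y t)) *m dy)^T *m Y (y t)) 0 0 =
  ((Y (y t))^T *m ((2 *: S (y t)) *m dy)) 0 0; last by [].
by rewrite !mxE; apply: eq_bigr => k _; rewrite [in LHS]mxE [in RHS]mxE mulrC.
Qed.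

Let dV_f p : dV p (f p) = - 2 * quad (Zmx p) (Y p).
Proof.
rewrite /dV /quad /Zmx /f !mulmxN scalemxAl !mulmxA.
set B := _ *m Y p; have -> : (- B) 0 0 = - B 0 0 by rewrite mxE.
by rewrite mulrN mulNr.
Qed.

(* [coer] applies to [Y p] itself, which is tangent to the image of [F] only to
   first order; half of its constant absorbs the change of [Zmx] from [pstar] to
   [p], and the factor [N%:R + 1] the passage from the max norm to [V]. *)
Let dissipation : exists2 c, 0 < c &
  \forall p \near pstar, c * V p <= quad (Zmx p) (Y p).
Proof.
have dF h : is_derive pstar h F ((2 *: S pstar) *m h).
  exact: (F_derive (is_derive_id _ _)).
have rA : \rank (2 *: S pstar) = r by rewrite mxrank_scale_nz// pnatr_eq0.
have FM p : range F (F p) by exists p.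
have cF : continuous F := lip_on_bounded_continuous F_lip.
have [G [Gker Gest]] := submanifold_tangent slice FM (cF pstar) dF rA.
have [c c0 coer] : exists2 c, 0 < c & forall y : 'cV_N,
    `|G *m y| <= c * `|y| -> c * `|y| ^+ 2 <= quad (Zmx pstar) y.
  apply: quad_coercive => y y0 /Gker[h yE].
  have yS : y = S pstar *m (2 *: h) by rewrite yE -scalemxAr -scalemxAl.
  by rewrite yS; apply: Z_pos; rewrite -yS.
have N0 : 0 < N%:R ^+ 2 + 1 :> R by rewrite ltr_pwDr// sqr_ge0.
pose e := c / 2 / (N%:R ^+ 2 + 1).
have e0 : 0 < e by rewrite /e !divr_gt0.
have Znear : \forall p \near pstar, `|Zmx pstar - Zmx p| < e.
  exact: (continuous_near_dist pstar Zmx_continuous e0).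
exists (c / 2 / (N%:R + 1)) => [|]; first by rewrite !divr_gt0// ltr_pwDr.
apply: (@filterS _ _ (nbhs_filter pstar) _ _ _ (filterI Znear (Gest c c0))).
move=> p [Zp Gp]; have cY := coer _ Gp.
have pert : `|quad (Zmx pstar - Zmx p) (Y p)| <= c / 2 * `|Y p| ^+ 2.
  apply: le_trans (mx_norm_entry _ 0 0) _.
  apply: (le_trans (mx_norm_mulmx _ _)).
  apply: (@le_trans _ _ (N%:R * (N%:R * `|(Y p)^T| * `|Zmx pstar - Zmx p|) * `|Y p|)).
    by rewrite ler_wpM2r// ler_wpM2l// mx_norm_mulmx.
  rewrite mx_norm_tr.
  have -> : N%:R * (N%:R * `|Y p| * `|Zmx pstar - Zmx p|) * `|Y p| =
    N%:R ^+ 2 * `|Zmx pstar - Zmx p| * `|Y p| ^+ 2 by ring.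
  rewrite ler_wpM2r ?sqr_ge0//.
  apply: (@le_trans _ _ ((N%:R ^+ 2 + 1) * e)).
    by rewrite ler_pM ?sqr_ge0// ?lerDl// ltW.
  by rewrite /e mulrC divfK// gt_eqF.
have quadB : quad (Zmx pstar - Zmx p) (Y p) = quad (Zmx pstar) (Y p) - quad (Zmx p) (Y p).
  rewrite /quad; move: (Y p) => y; rewrite mulmxBr mulmxBl.
  by rewrite [LHS]mxE; congr (_ + _); rewrite mxE.
move: pert; rewrite quadB ler_norml => /andP[_ pert].
have low : c / 2 * `|Y p| ^+ 2 <= quad (Zmx p) (Y p).
  move: cY; rewrite -/(Y p); lra.
apply: le_trans low; rewrite -mulrA.
apply: ler_wpM2l; first by rewrite divr_ge0// ltW.
rewrite mulrC ler_pdivrMr ?ltr_pwDr//; apply: le_trans (V_le p) _.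
by rewrite mulrC ler_wpM2l ?sqr_ge0// lerDl.
Qed.

Lemma quadratic_flow_converges :
  exp_convergent_near f [set q | F q = F pstar] pstar.
Proof.
(* The radius is halved for the closed ball to fit in the region of dissipation. *)
have [c c0] := dissipation => /nbhs_ballP[delta0 /= delta00 diss].
pose delta := delta0 / 2.
have delta_gt0 : 0 < delta by rewrite divr_gt0.
have [K K0 fK] := f_lip (`|pstar| + delta).
have [C1 C10 DC1] := lip_on_bounded_linear D (`|pstar| + delta).
have ball_bd p : `|p - pstar| <= delta -> `|p| <= `|pstar| + delta.
  move=> h; rewrite -[p](subrK pstar) addrC.
  by apply: le_trans (ler_normD _ _) _; rewrite lerD2l.
pose C := N%:R * C1.
have C0 : 0 <= C by rewrite mulr_ge0.
have decr p : `|p - pstar| < delta -> dV p (f p) <= - (2 * c) * V p.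
  move=> h; rewrite dV_f.
  have : c * V p <= quad (Zmx p) (Y p).
    apply: diss; rewrite -ball_normE /= distrC; apply: lt_trans h _.
    by rewrite /delta; lra.
  lra.
have fle p : `|p - pstar| < delta -> `|f p| <= C * Num.sqrt (V p).
  move=> /ltW/ball_bd h; rewrite /f normrN.
  apply: (le_trans (mx_norm_mulmx _ _)); rewrite mx_norm_tr.
  have [Dp _] := DC1 p p h h.
  by apply: ler_pM; rewrite ?mulr_ge0// ler_wpM2l.
pose ft p := f (clamp pstar delta p).
have ft_eq p : `|p - pstar| <= delta -> ft p = f p.
  by move=> h; rewrite /ft clamp_id.
have cb p : `|clamp pstar delta p| <= `|pstar| + delta.
  by apply: ball_bd; exact: clamp_ball.
have ft_bd p : `|ft p| <= K by have [] := fK _ _ (cb p) (cb p).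
have K1 : 0 < K + 1 by rewrite ltr_pwDr.
have ft_lip p q : `|ft p - ft q| <= (K + 1) * `|p - q|.
  have [_ h] := fK _ _ (cb p) (cb q); apply: (le_trans h).
  by apply: ler_pM => //; [rewrite lerDl|exact: clamp_lip].
have decrt p : `|p - pstar| < delta -> dV p (ft p) <= - (2 * c) * V p.
  by move=> h; rewrite (ft_eq _ (ltW h)); exact: decr.
have flet p : `|p - pstar| < delta -> `|ft p| <= C * Num.sqrt (V p).
  by move=> h; rewrite (ft_eq _ (ltW h)); exact: fle.
exists [set p | `|p - pstar| < delta / 2 /\ C * Num.sqrt (V p) < c * (delta / 2)].
exists (delta * (m%:R + 1)); exists c; split => //.
- pose e := c * (delta / 2) / (C + 1).
  have C1p : 0 < C + 1 by rewrite ltr_pwDr.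
  have e0 : 0 < e by rewrite !divr_gt0// !mulr_gt0// ?invr_gt0.
  have idc : continuous (@id 'cV[R]_m) by exact: lip_on_bounded_continuous id_lip.
  have n1 := continuous_near_dist pstar idc (divr_gt0 delta_gt0 (ltr0n R 2)).
  have n2 := continuous_near_dist pstar V_continuous (exprn_gt0 2 e0).
  apply: (@filterS _ _ (nbhs_filter pstar) _ _ _ (filterI n1 n2)) => p [p1 p2].
  split; first by rewrite distrC.
  have Vp0 : V pstar = 0 by rewrite /V /Y subrr mulmx0 mxE.
  move: p2; rewrite /= Vp0 sub0r normrN ger0_norm// => p2.
  have s1 : Num.sqrt (V p) < e.
    by rewrite -[ltRHS]ger0_norm ?ltW// -sqrtr_sqr ltr_sqrt// exprn_gt0.
  have -> : c * (delta / 2) = (C + 1) * e by rewrite [RHS]mulrC /e divfK// gt_eqF.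
  apply: (@le_lt_trans _ _ ((C + 1) * Num.sqrt (V p))).
    by rewrite ler_wpM2r ?sqrtr_ge0// lerDl.
  by rewrite ltr_pM2l.
- by rewrite mulr_gt0// ltr_pwDr.
move=> x0 [x0n x0V]; split.
  have [x [x00 xD]] := picard_lindelof ft_bd K1 ft_lip x0.
  have xt : trajectory ft x by exact: trajectory_of_is_derive.
  exists x; split => //; move: x0n x0V; rewrite -x00 => x0n /ltW x0V.
  have [inside _] := lyapunov_decay delta_gt0 c0 C0 V_continuous V_ge0 V_chain
    decrt flet xt x0n x0V.
  have [xt1 xt2] := xt; split=> [t t0|].
    by rewrite -ft_eq ?ltW//; [exact: xt1|apply: inside; exact: ltW].
  by rewrite -ft_eq ?ltW// inside.
move=> x xt x00; move: x0n x0V; rewrite -x00 => x0n /ltW x0V.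
have [_ [q [Vq qx]]] := lyapunov_decay delta_gt0 c0 C0 V_continuous V_ge0 V_chain
  decr fle xt x0n x0V.
exists q; split; first exact: V_eq0.
move=> t t0; apply: (le_trans (enorm_le _)).
rewrite mulrAC [leRHS]mulrC; apply: ler_wpM2l; first by rewrite addr_ge0.
exact: qx.
Qed.

End QuadraticMeasurement.

(** * Rigidity matrices *)

Section RigidityAlgebra.
Variables (R : realType) (n d : nat) (e o : rel 'I_n).
Implicit Types p q h : 'cV[R]_(n * d).

Lemma vertex_ptE p i k : vertex_pt p i 0 k = p (mxvec_index i k) 0.
Proof. by rewrite /vertex_pt !mxE. Qed.

Lemma edge_blockE p (a : 'I_#|edges e|) v k : edge_block p a v 0 k =
  if v == end1 a then p (mxvec_index (end1 a) k) 0 - p (mxvec_index (end2 a) k) 0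
  else if v == end2 a then p (mxvec_index (end2 a) k) 0 - p (mxvec_index (end1 a) k) 0
  else 0.
Proof.
by rewrite /edge_block; case: ifP => _; [|case: ifP => _]; rewrite ?mxE -?vertex_ptE ?mxE.
Qed.

Lemma rigidity_mxE p (a : 'I_#|edges e|) v k :
  rigidity_mx e p a (mxvec_index v k) = edge_block p a v 0 k.
Proof. by rewrite /rigidity_mx mxE mxvecE mxE. Qed.

Lemma dir_rigidity_mxE p (a : 'I_#|edges e|) v k :
  dir_rigidity_mx e o p a (mxvec_index v k) =
  if v == head_of o a then 0 else edge_block p a v 0 k.
Proof. by rewrite /dir_rigidity_mx mxE mxvecE mxE; case: ifP => //; rewrite mxE. Qed.

Let mxDZ a b (t : R) (A B : 'M[R]_(a, b)) i j :
  (t *: A + B) i j = t * A i j + B i j.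
Proof. by rewrite !mxE. Qed.

Let mxB a b (A B : 'M[R]_(a, b)) i j : (A - B) i j = A i j - B i j.
Proof. by rewrite !mxE. Qed.

Lemma rigidity_mx_linear : linear (@rigidity_mx R n d e).
Proof.
move=> t p q; apply/matrixP => a j; case/mxvec_indexP: j => v k.
rewrite mxDZ !rigidity_mxE !edge_blockE.
by rewrite !mxDZ; case: ifP => _; [|case: ifP => _]; ring.
Qed.

Lemma dir_rigidity_mx_linear : linear (@dir_rigidity_mx R n d e o).
Proof.
move=> t p q; apply/matrixP => a j; case/mxvec_indexP: j => v k.
rewrite mxDZ !dir_rigidity_mxE !edge_blockE.
by rewrite !mxDZ; case: ifP => _; [|case: ifP => _; [|case: ifP => _]]; ring.
Qed.

HB.instance Definition _ := GRing.isLinear.Build R _ _ _ (@rigidity_mx R n d e)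
  rigidity_mx_linear.
HB.instance Definition _ := GRing.isLinear.Build R _ _ _ (@dir_rigidity_mx R n d e o)
  dir_rigidity_mx_linear.

Lemma end12_neq (a : 'I_#|edges e|) : end1 a != end2 a.
Proof.
have := enum_valP a; rewrite inE /end1 /end2 => /andP[+ _].
by apply: contraTneq => ->; rewrite ltnn.
Qed.

(** The bilinear form behind the rigidity matrix: polarising the squared length of
    an edge, it is symmetric in the two configurations. *)
Lemma rigidity_mx_mul p h a : (rigidity_mx e p *m h) a 0 =
  \sum_k (p (mxvec_index (end1 a) k) 0 - p (mxvec_index (end2 a) k) 0) *
         (h (mxvec_index (end1 a) k) 0 - h (mxvec_index (end2 a) k) 0).
Proof.
rewrite mxE (reindex _ (curry_mxvec_bij _ _)) /=.
rewrite (eq_bigr (fun vk => rigidity_mx e p a (mxvec_index vk.1 vk.2) *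
   h (mxvec_index vk.1 vk.2) 0)); last by case.
rewrite -(pair_bigA _ (fun v k => rigidity_mx e p a (mxvec_index v k) *
   h (mxvec_index v k) 0)) /= exchange_big /=; apply: eq_bigr => k _.
rewrite (bigD1 (end1 a))//= (bigD1 (end2 a)) ?(eq_sym (end2 a)) ?end12_neq//=.
rewrite big1 => [|v /andP[v1 v2]]; rewrite rigidity_mxE edge_blockE.
  rewrite rigidity_mxE edge_blockE !eqxx eq_sym (negbTE (end12_neq a)); ring.
by rewrite (negbTE v1) (negbTE v2) mul0r.
Qed.

Lemma rigidity_mx_sym p h : rigidity_mx e p *m h = rigidity_mx e h *m p.
Proof.
apply/colP => a; rewrite !rigidity_mx_mul; apply: eq_bigr => k _.
by rewrite mulrC.
Qed.

Lemma distance_mapE p : distance_map e p = rigidity_mx e p *m p.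
Proof.
apply/colP => a; rewrite rigidity_mx_mul mxE /enorm sqr_sqrtr; last first.
  by apply: sumr_ge0 => i _; apply: sumr_ge0 => j _; exact: sqr_ge0.
rewrite big_ord1; apply: eq_bigr => k _; rewrite -expr2 mxB !vertex_ptE.
by rewrite -sqrrN opprB.
Qed.

End RigidityAlgebra.

Lemma quad_sym (R : realType) N (Z : 'M[R]_N) (y : 'cV[R]_N) :
  quad (2^-1 *: (Z + Z^T)) y = quad Z y.
Proof.
have tr : quad Z^T y = quad Z y.
  rewrite /quad; have -> : y^T *m Z^T *m y = (y^T *m Z *m y)^T.
    by rewrite !trmx_mul trmxK mulmxA.
  by rewrite mxE.
rewrite /quad -scalemxAr -scalemxAl mxE mulmxDr mulmxDl mxE -!/(quad _ _) tr.
by field.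
Qed.

Theorem theorem3 (R : realType) (n d : nat) (hd : (0 < d)%N)
    (e : rel 'I_n) (he : simple_graph e)
    (hrigid : generically_rigid R d e)
    (pstar : 'cV[R]_(n * d)) (hpstar : regular_points R d e pstar)
    (mstar : 'cV[R]_#|edges e|) (hmstar : mstar = distance_map e pstar)
    (o : rel 'I_n) (ho : orientation e o)
    (s : nat) (P : 'M[R]_(#|edges e|, s))
    (hPfree : row_free P^T)
    (hPspan : (P^T == (rigidity_mx e pstar)^T)%MS)
    (Z : 'M[R]_#|edges e|)
    (hZ : Z = 2 *: (rigidity_mx e pstar *m (dir_rigidity_mx e o pstar)^T))
    (hpos : posdefmx (2^-1 *: (P^T *m (Z + Z^T) *m P))) :
  exp_convergent_near (directed_controller o mstar)
    [set q | distance_map e q = mstar] pstar.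
Proof.
have [_ slice rank_eq] := hpstar.
have FE : distance_map e = (fun p : 'cV[R]_(n * d) => rigidity_mx e p *m p).
  by apply/funext => p; rewrite distance_mapE.
have Pquad (w : 'cV[R]_s) :
    (w^T *m (2^-1 *: (P^T *m (Z + Z^T) *m P)) *m w) 0 0 = quad Z (P *m w).
  by rewrite -quad_sym /quad trmx_mul -!(scalemxAr, scalemxAl) !mulmxA.
(* The columns of [P] span those of the rigidity matrix, so that [hpos] speaks of
   all velocities of the measurements at [pstar]. *)
have Zpos h : rigidity_mx e pstar *m h != 0 -> 0 < quad Z (rigidity_mx e pstar *m h).
  have /andP[_ /submxP[W RW]] := hPspan.
  have -> : rigidity_mx e pstar = P *m W^T by rewrite -[LHS]trmxK RW trmx_mul trmxK.
  rewrite -mulmxA; set v := W^T *m h => Pv0.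
  have v0 : v != 0 by apply: contraNneq Pv0 => ->; rewrite mulmx0.
  by rewrite -Pquad; exact: hpos.
rewrite hmstar FE in slice *.
rewrite hZ in Zpos.
have := @quadratic_flow_converges R (n * d) _ _ (rigidity_mx e) (dir_rigidity_mx e o)
  (@rigidity_mx_sym R n d e) pstar slice (rank_eq _ erefl) Zpos.
exact.
Qed.
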